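(* For an integer $k\ge2$, define $$C_k:=\inf_{x\ge1}\left\{1+x^{-4k/3}\bigl((1+x+x^2)^k-1\bigr)\right\}.$$ Then $$H(\Gamma_{3^k})\le\log C_k,\qquad C_k<3^k.$$ In particular, with $$x_0:=\frac{1+\sqrt{33}}4,\qquad\gamma:=(1+x_0+x_0^2)x_0^{-4/3}\approx2.755104613024,$$ one has $$C_k\le1+\gamma^k-x_0^{-4k/3}<1+\gamma^k.$$
   Context: For $q=3^k$ let $\tau_q(x,y,z)=1-(xy+yz+zx)^{q-1}$, a polynomial over $\mathbb{F}_q$; every variable occurs in it with exponent at most $q-1$. $\Gamma_q\subseteq\{0,\dots,q-1\}^3$ is its support in the monomial basis, i.e. the set of exponent triples $(u,v,w)$ such that $x^uy^vz^w$ has nonzero coefficient (in characteristic three) in $\tau_q$. Logarithms are natural; for a probability distribution $\mu$ on a finite set $H(\mu)=-\sum_x\mu(x)\log\mu(x)$ (with $0\log0=0$), and for nonempty $\Gamma\subseteq\{0,\dots,q-1\}^3$, $H(\Gamma)=\max_\mu\min_{1\le i\le3}H(\mu_i)$, where $\mu$ ranges over probability distributions on $\Gamma$ and $\mu_i$ is its $i$-th marginal. The infimum is over real $x\ge1$. *)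

(* Defs.v *)
From mathcomp Require Import all_boot all_order all_algebra.
From mathcomp Require mpoly.

Set Implicit Arguments.
Unset Strict Implicit.
Unset Printing Implicit Defensive.

Import Order.TTheory GRing.Theory Num.Theory.
Local Open Scope ring_scope.

(* mpoly is imported only inside this module, and before mathcomp-analysis is
   loaded, because their notations clash. *)
Module Tau.
Import mpoly.

Definition tau (F : fieldType) (q : nat) : {mpoly F[3]} :=
  let x : {mpoly F[3]} := 'X_(@Ordinal 3 0 isT) in
  let y : {mpoly F[3]} := 'X_(@Ordinal 3 1 isT) in
  let z : {mpoly F[3]} := 'X_(@Ordinal 3 2 isT) in
  1 - (x * y + y * z + z * x) ^+ (q - 1).

Definition Gamma (F : fieldType) (q : nat) : {set 'I_q * 'I_q * 'I_q} :=
  [set e | (tau F q)@_[multinom [tuple val e.1.1; val e.1.2; val e.2]] != 0].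

(* Restricting to exponents below q in [Gamma] drops no monomial of [tau]. *)
Lemma tau_exponent_lt (F : fieldType) (q : nat) (m : 'X_{1..3}) (i : 'I_3) :
  (0 < q)%N -> (tau F q)@_m != 0 -> (m i < q)%N.
Proof.
move=> q0; rewrite -mcoeff_msupp /tau.
set p := _ + _ + _; rewrite /= in p *.
have supp_p m' : m' \in msupp p -> (m' i <= 1)%N.
  have supp_XX (a b : 'I_3) : a != b ->
      m' \in msupp ('X_a * 'X_b : {mpoly F[3]}) -> (m' i <= 1)%N.
    move=> ab; rewrite -mpolyXD msuppX inE => /eqP ->; rewrite mnmDE !mnm1E.
    case: (a =P i) => [<-|_]; first by rewrite eq_sym (negPf ab).
    by case: (b == i).
  move=> /msuppD_le; rewrite mem_cat => /orP[/msuppD_le|]; last by apply: supp_XX.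
  by rewrite mem_cat => /orP[]; apply: supp_XX.
have supp_pX n m' : m' \in msupp (p ^+ n) -> (m' i <= n)%N.
  elim: n m' => [|n IH] m'.
    by rewrite expr0 msupp1 inE => /eqP ->; rewrite mnmE.
  rewrite exprS => /msuppM_le /allpairsP[[m1 m2] /= [h1 h2 ->]].
  by rewrite mnmDE -[n.+1]add1n leq_add ?supp_p ?IH.
move=> /msuppB_le; rewrite mem_cat => /orP[|/supp_pX h].
  by rewrite msupp1 inE => /eqP ->; rewrite mnmE.
by rewrite -(subnK q0) addn1 ltnS.
Qed.

End Tau.

Definition tau := Tau.tau.
Definition Gamma := Tau.Gamma.

From mathcomp Require Import all_classical all_reals all_analysis.

Section Reals.
Variable R : realType.

(* [ln 0 = 0] in the library, so 0 log 0 = 0. *)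
Definition entropy (T : finType) (mu : T -> R) : R :=
  - \sum_(t : T) mu t * ln (mu t).

Definition distribution_on (T : finType) (G : {set T}) (mu : T -> R) : Prop :=
  [/\ forall t, 0 <= mu t, \sum_(t : T) mu t = 1
    & forall t, t \notin G -> mu t = 0].

Definition marginal (T U : finType) (proj : T -> U) (mu : T -> R) : U -> R :=
  fun u => \sum_(t : T | proj t == u) mu t.

Definition min_marginal_entropy (q : nat)
    (mu : 'I_q * 'I_q * 'I_q -> R) : R :=
  Num.min (entropy (marginal (fun e => e.1.1) mu))
    (Num.min (entropy (marginal (fun e => e.1.2) mu))
             (entropy (marginal (fun e => e.2) mu))).

(* The maximum over distributions on a nonempty G is attained, since a
   continuous function is maximised over a simplex; [sup] is that maximum. *)
Definition H (q : nat) (G : {set 'I_q * 'I_q * 'I_q}) : R :=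
  sup [set min_marginal_entropy mu | mu in distribution_on G]%classic.

Definition C (k : nat) : R :=
  inf [set 1 + x `^ (- (4 * k%:R / 3)) * ((1 + x + x ^+ 2) ^+ k - 1)
      | x in [set x : R | 1 <= x]]%classic.

Definition x0 : R := (1 + Num.sqrt 33) / 4.

Definition gamma : R := (1 + x0 + x0 ^+ 2) * x0 `^ (- (4 / 3)).

(* 2.755104613024, in blocks of three digits because numerals are unary. *)
Definition gamma_approx : R :=
  2 + 755 / 10 ^+ 3 + 104 / 10 ^+ 6 + 613 / 10 ^+ 9 + 24 / 10 ^+ 12.

End Reals.

(* Main.v *)
Require Import Defs.
From mathcomp Require Import all_boot all_order all_algebra.
From mathcomp Require mpoly.

Import Order.TTheory GRing.Theory Num.Theory.
Local Open Scope ring_scope.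

(** The entropy bound rests on one fact about base-three digits: a monomial
    x^u y^v z^w of tau other than the constant has exponents whose digit sums
    add up to 4k.  Indeed 3^(k+1) - 1 = 3 (3^k - 1) + 2, cubing is additive in
    characteristic three and so only triples exponents, and the remaining factor
    (xy+yz+zx)^2 contributes one digit in {0, 1, 2} to each coordinate, of total
    4 ([digit_sum_e2_exp]).

    Given x >= 1, put on {0, ..., 3^k - 1} the weight 1 at 0 and
    x^(s(u) - 4k/3) at u <> 0, where s is the digit sum.  As the generating
    function of s is (1+x+x^2)^k, the total weight is exactly the function of x
    whose infimum is C_k.  Gibbs' inequality bounds each marginal entropy by the
    logarithm of the total weight minus the mean log-weight.  Summing over the
    three coordinates, the log-weights of an exponent triple add up to 0 at the
    origin, and to at least (4k - 3 * 4k/3) log x = 0 elsewhere, since giving 0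
    the weight 1 instead of x^(-4k/3) only increases it.  Hence the
    average of the three entropies, and a fortiori their minimum, is at most the
    logarithm of the total weight ([min_marginal_entropy_le]).

    The other claims come from x = x0, a root of 2x^2 = x + 4.  Reducing with
    this relation gives gamma^3 = 27/512 (207 + 33 sqrt 33) ([gamma_cube]),
    hence the decimals of gamma from those of sqrt 33; and gamma < 2.8
    yields 1 + gamma^k < 3^k for k >= 2. *)

(** * Digit sums of the exponents of tau *)

(** The sum of the [k] lowest base-three digits; the number of digits is the
    recursion variable because it is also the exponent in the order of the field. *)
Fixpoint digit_sum (k u : nat) : nat :=
  if k is k'.+1 then (u %% 3 + digit_sum k' (u %/ 3))%N else 0%N.

Arguments digit_sum : simpl never.

Lemma digit_sum0 k : digit_sum k 0 = 0%N.
Proof. by elim: k. Qed.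

Lemma digit_sum_cons k d a : (d < 3)%N ->
  digit_sum k.+1 (3 * a + d) = (d + digit_sum k a)%N.
Proof.
by move=> d3; rewrite /digit_sum -/digit_sum mulnC modnMDl divnMDl //
  modn_small // divn_small // addn0.
Qed.

Section TauSupport.
Import mpoly.

(** Cubing is additive in characteristic three, so no mixed monomials arise. *)
Lemma msupp_cube (F : fieldType) n (p : {mpoly F[n]}) m :
  3%N \in [pchar F] -> m \in msupp (p ^+ 3) ->
  exists2 m', m' \in msupp p & m = (m' *+ 3)%MM.
Proof.
move=> F3.
have ch3 : 3%N \in [pchar {mpoly F[n]}] by rewrite pchar_lalg.
have -> : p ^+ 3 = \sum_(m' <- msupp p) (p@_m' ^+ 3) *: 'X_[m' *+ 3].
  rewrite -(pFrobenius_autE ch3) {1}[p]mpolyE raddf_sum.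
  by apply: eq_bigr => m' _; rewrite /= pFrobenius_autE exprZn mpolyXn.
move=> /msupp_sum_le; rewrite filter_predT => /flatten_mapP[m' m'p].
by move=> /msuppZ_le; rewrite msuppX inE => /eqP ->; exists m'.
Qed.

(** The second elementary symmetric polynomial in three variables, written out so
    that [tau F q] is [1 - e2 F ^+ (q - 1)] by conversion. *)
Definition e2 (F : fieldType) : {mpoly F[3]} :=
  'X_(@Ordinal 3 0 isT) * 'X_(@Ordinal 3 1 isT)
  + 'X_(@Ordinal 3 1 isT) * 'X_(@Ordinal 3 2 isT)
  + 'X_(@Ordinal 3 2 isT) * 'X_(@Ordinal 3 0 isT).

Lemma msupp_e2 (F : fieldType) m : m \in msupp (e2 F) ->
  (forall i, m i <= 1)%N /\ (\sum_i m i = 2)%N.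
Proof.
have mXX (a b : 'I_3) : a != b -> m \in msupp ('X_a * 'X_b : {mpoly F[3]}) ->
    (forall i, m i <= 1)%N /\ (\sum_i m i = 2)%N.
  move=> ab; rewrite -mpolyXD msuppX inE => /eqP ->; split=> [i|].
    rewrite mnmDE !mnm1E; case: (a =P i) => [<-|_]; last by case: eqP.
    by rewrite eq_sym (negPf ab).
  by rewrite -mdegE mdegD !mdeg1.
by move=> /msuppD_le; rewrite mem_cat => /orP[/msuppD_le|];
  rewrite ?mem_cat; [move=> /orP[]|]; apply: mXX.
Qed.

(** Induction on [k]: in [(e2 ^+ (3 ^ k - 1)) ^+ 3 * e2 ^+ 2] the second factor has
    exponents at most 2, so it supplies the lowest digits without any carry. *)
Lemma digit_sum_e2_exp (F : fieldType) k m : 3%N \in [pchar F] ->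
  m \in msupp (e2 F ^+ (3 ^ k - 1)) ->
  (\sum_(i < 3) digit_sum k (m i) = 4 * k)%N.
Proof.
move=> F3; elim: k m => [|k IH] m.
  by move=> _; rewrite big1.
have -> : (3 ^ k.+1 - 1 = (3 ^ k - 1) * 3 + 2)%N.
  rewrite expnS; case: (3 ^ k)%N (expn_gt0 3 k) => // n _.
  by rewrite mulnS !subn1 /= mulnC addnC.
rewrite exprD exprM => /msuppM_le /allpairsP[[m1 m2] /= [h1 h2 ->]].
have [m' /IH IHm' ->] := msupp_cube _ _ _ _ F3 h1.
move: h2; rewrite expr2 => /msuppM_le /allpairsP[[a b] /= [ha hb ->]].
have [a1 a2] := msupp_e2 _ _ ha; have [b1 b2] := msupp_e2 _ _ hb.
transitivity (\sum_(i < 3) ((a i + b i) + digit_sum k (m' i)))%N; last first.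
  by rewrite !big_split /= a2 b2 IHm' mulnS.
apply: eq_bigr => i _; rewrite mnmDE mulmnE mnmDE mulnC digit_sum_cons //.
by rewrite ltnS (leq_add (a1 i) (b1 i)).
Qed.

(** The first alternative is the constant monomial of tau, whose digit sums
    are all 0. *)
Lemma Gamma_digit_sum (F : fieldType) k (e : 'I_(3 ^ k) * 'I_(3 ^ k) * 'I_(3 ^ k)) :
  3%N \in [pchar F] -> e \in Gamma F (3 ^ k) ->
  [/\ e.1.1 = 0 :> nat, e.1.2 = 0 :> nat & e.2 = 0 :> nat]%N \/
  (digit_sum k e.1.1 + digit_sum k e.1.2 + digit_sum k e.2 = 4 * k)%N.
Proof.
move=> F3; rewrite inE -mcoeff_msupp /Tau.tau => /msuppB_le.
rewrite mem_cat => /orP[|/(digit_sum_e2_exp _ _ _ F3) <-]; last first.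
  by right; rewrite !big_ord_recl big_ord0 addn0 addnA.
rewrite msupp1 inE => /eqP/mnmP e0; left.
by split; [have := e0 (@Ordinal 3 0 isT) | have := e0 (@Ordinal 3 1 isT)
  | have := e0 (@Ordinal 3 2 isT)]; rewrite !mnmE.
Qed.

End TauSupport.

From mathcomp Require Import all_classical all_reals all_analysis.
From mathcomp Require Import finfield ring lra.
Local Open Scope ring_scope.

(** The digits of [u] vary independently over {0, 1, 2}, so the generating
    function factors; the induction splits [u] as [3 * a + d]. *)
Lemma digit_sum_gen (R : comNzRingType) (x : R) k :
  \sum_(u < 3 ^ k) x ^+ digit_sum k u = (1 + x + x ^+ 2) ^+ k.
Proof.
elim: k => [|k IH]; first by rewrite big_ord_recl big_ord0 addr0.
rewrite -(big_mkord xpredT (fun u => x ^+ digit_sum k.+1 u)) expnS mulnC.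
rewrite big_nat_mul big_mkord exprS -IH mulr_sumr; apply: eq_bigr => a _.
rewrite -{1}[(a * 3)%N]add0n big_addn mulSn addnK !big_nat_recr //= big_geq //.
rewrite add0r ![(_ + a * 3)%N]addnC !(mulnC a) !digit_sum_cons // add0n !exprD.
ring.
Qed.

(** * Entropy of marginals *)

Section Gibbs.
Variable R : realType.
Implicit Types T U : finType.

(** Nonnegativity of the relative entropy of [p] with respect to the normalised
    weights [phi t / Z], from [ln r <= r - 1] at [r = phi t / Z / p t]. *)
Lemma gibbs T (p phi : T -> R) :
  (forall t, 0 <= p t) -> \sum_t p t = 1 -> (forall t, 0 < phi t) ->
  entropy p <= ln (\sum_t phi t) - \sum_t p t * ln (phi t).
Proof.
move=> p0 p1 phi0; set Z := \sum_t phi t.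
have Z0 : 0 < Z.
  have [t _ _] : exists2 t, true & p t != 0.
    apply/exists2P => /=; apply: contrapT => /forallNP h.
    have : \sum_t p t = 0.
      by apply: big1 => t _; apply/eqP/negP => /negP pt; apply: (h t).
    by rewrite p1 => /eqP; rewrite oner_eq0.
  by rewrite /Z (bigD1 t) //= ltr_wpDr ?phi0 // sumr_ge0 // => i _; exact: ltW.
have pt t : p t * ln (phi t) - p t * ln Z - p t * ln (p t) <= phi t / Z - p t.
  have [->|pt0] := eqVneq (p t) 0.
    by rewrite !mul0r !subr0 divr_ge0 // ltW.
  have pt_gt0 : 0 < p t by rewrite lt_neqAle eq_sym pt0 p0.
  have r0 : 0 < phi t / Z / p t by rewrite !divr_gt0.
  have := @le_ln1Dx R (phi t / Z / p t - 1).
  rewrite [1 + _]addrC subrK ltrBrDl subrr => /(_ r0).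
  rewrite !ln_div ?posrE ?divr_gt0 // => h.
  rewrite -!mulrBr -{3}[p t]mulr1 (_ : phi t / Z = p t * (phi t / Z / p t)); last first.
    by rewrite mulrCA divff // mulr1.
  by rewrite -mulrBr ler_wpM2l.
have : \sum_t (p t * ln (phi t) - p t * ln Z - p t * ln (p t))
       <= \sum_t (phi t / Z - p t) by apply: ler_sum.
rewrite !sumrB -mulr_suml -!mulr_suml p1 mul1r -/Z divff ?gt_eqF // subrr.
rewrite /entropy; lra.
Qed.

Lemma marginal_ge0 T U (proj : T -> U) (mu : T -> R) :
  (forall t, 0 <= mu t) -> forall u, 0 <= marginal proj mu u.
Proof. by move=> mu0 u; apply: sumr_ge0. Qed.

Lemma sum_marginal T U (proj : T -> U) (mu : T -> R) (g : U -> R) :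
  \sum_u marginal proj mu u * g u = \sum_t mu t * g (proj t).
Proof.
rewrite [RHS](partition_big proj xpredT) //=; apply: eq_bigr => u _.
by rewrite mulr_suml; apply: eq_bigr => t /eqP ->.
Qed.

End Gibbs.

(** * The entropy bound *)

Section Majorant.
Variables (R : realType) (k : nat).
Implicit Types x y : R.

(** The function whose infimum over [x >= 1] is [C R k]. *)
Definition majorant x : R :=
  1 + x `^ (- (4 * k%:R / 3)) * ((1 + x + x ^+ 2) ^+ k - 1).

Lemma majorant_ge1 x : 1 <= x -> 1 <= majorant x.
Proof.
move=> x1; rewrite lerDl mulr_ge0 ?powR_ge0 // subr_ge0 exprn_ege1 //.
by rewrite -addrA lerDl addr_ge0 ?exprn_ge0 //; lra.
Qed.

Lemma C_le_majorant x : 1 <= x -> C R k <= majorant x.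
Proof.
move=> x1; apply: ge_inf; last by exists x.
by exists 1 => _ [y /= y1 <-]; exact: majorant_ge1.
Qed.

Lemma le_C y : (forall x, 1 <= x -> y <= majorant x) -> y <= C R k.
Proof.
move=> yM; apply: lb_le_inf; first by exists (majorant 1), 1 => /=.
by move=> _ [x /= x1 <-]; exact: yM.
Qed.

Lemma C_gt0 : 0 < C R k.
Proof. exact: lt_le_trans ltr01 (le_C _ majorant_ge1). Qed.

(** The weight at 0 is 1 rather than x^(-4k/3) so that the origin, which violates
    the digit-sum identity, has total log-weight 0. *)
Definition weight x (u : nat) : R :=
  if u == 0%N then 1 else x ^+ digit_sum k u * x `^ (- (4 * k%:R / 3)).

Lemma weight_gt0 x u : 0 < x -> 0 < weight x u.
Proof.
by move=> x0; rewrite /weight; case: eqP => // _; rewrite mulr_gt0 ?exprn_gt0 ?powR_gt0.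
Qed.

Lemma sum_weight x : \sum_(u < 3 ^ k) weight x u = majorant x.
Proof.
have q0 : (0 < 3 ^ k)%N by rewrite expn_gt0.
rewrite /majorant -digit_sum_gen (bigD1 (Ordinal q0)) //=.
rewrite [in RHS](bigD1 (Ordinal q0)) //= digit_sum0 expr0.
rewrite [1 + _ - 1]addrC addKr mulr_sumr; congr (_ + _).
apply: eq_bigr => u u0; rewrite /weight mulrC ifN //.
Qed.

(** Equality holds for [u <> 0]; at [u = 0] the left side is -(4k/3) ln x, which is
    nonpositive as [x >= 1]. *)
Lemma ln_weight_ge x u : 1 <= x ->
  ((digit_sum k u)%:R - 4 * k%:R / 3) * ln x <= ln (weight x u).
Proof.
move=> x1; have x0 : 0 < x by lra.
rewrite /weight; case: eqP => [->|_].
  have := mulr_ge0 (ler0n R k) (ln_ge0 x1).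
  rewrite digit_sum0 sub0r ln1 mulNr; lra.
rewrite lnM ?posrE ?exprn_gt0 ?powR_gt0 // lnXn // ln_powR mulrBl mulNr.
by rewrite -[ln x *+ _]mulr_natl.
Qed.

Lemma marginal_entropy_le (T : finType) (mu : T -> R) (proj : T -> 'I_(3 ^ k)) x :
  (forall t, 0 <= mu t) -> \sum_t mu t = 1 -> 1 <= x ->
  entropy (marginal proj mu)
    <= ln (majorant x) - \sum_t mu t * ln (weight x (proj t)).
Proof.
move=> mu0 mu1 x1; rewrite -sum_weight.
rewrite -(sum_marginal _ _ _ proj mu (fun u => ln (weight x u))).
apply: gibbs => [|| u].
- exact: marginal_ge0.
- transitivity (\sum_u marginal proj mu u * 1).
    by apply: eq_bigr => u _; rewrite mulr1.
  rewrite (sum_marginal _ _ _ proj mu (fun=> 1)) -[RHS]mu1; apply: eq_bigr => t _; exact: mulr1.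
- by apply: weight_gt0; lra.
Qed.

(** The minimum is at most the average of the three bounds of
    [marginal_entropy_le], in which the mean log-weights sum to something
    nonnegative: each triple of [Gamma] has nonnegative total log-weight, either
    because it is the origin or because its digit sums cancel the three
    terms 4k/3. *)
Lemma min_marginal_entropy_le (F : fieldType) mu x : 3%N \in [pchar F] ->
  distribution_on (Gamma F (3 ^ k)) mu -> 1 <= x ->
  min_marginal_entropy mu <= ln (majorant x).
Proof.
move=> F3 [mu0 mu1 muG] x1.
have h1 := marginal_entropy_le _ mu (fun e => e.1.1) x mu0 mu1 x1.
have h2 := marginal_entropy_le _ mu (fun e => e.1.2) x mu0 mu1 x1.
have h3 := marginal_entropy_le _ mu (fun e => e.2) x mu0 mu1 x1.
have : 0 <= \sum_e mu e * ln (weight x e.1.1) + \sum_e mu e * ln (weight x e.1.2)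
            + \sum_e mu e * ln (weight x e.2).
  rewrite -!big_split; apply: sumr_ge0 => e _ /=; rewrite -!mulrDr.
  have [eG|/muG ->] := boolP (e \in Gamma F (3 ^ k)); last by rewrite mul0r.
  apply: mulr_ge0 => //.
  have [[-> -> ->]|ds] := Gamma_digit_sum F k e F3 eG.
    by rewrite /weight /= ln1 !addr0.
  have w1 := ln_weight_ge x e.1.1 x1; have w2 := ln_weight_ge x e.1.2 x1.
  have w3 := ln_weight_ge x e.2 x1.
  have dsR : (digit_sum k e.1.1)%:R + (digit_sum k e.1.2)%:R
             + (digit_sum k e.2)%:R = 4 * k%:R :> R by rewrite -!natrD ds natrM.
  by move: (congr1 (fun d => d * ln x) dsR) => /=; lra.
have m1 : min_marginal_entropy mu <= entropy (marginal (fun e => e.1.1) mu).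
  by rewrite ge_min lexx.
have m2 : min_marginal_entropy mu <= entropy (marginal (fun e => e.1.2) mu).
  by rewrite !ge_min lexx orbT.
have m3 : min_marginal_entropy mu <= entropy (marginal (fun e => e.2) mu).
  by rewrite !ge_min lexx !orbT.
lra.
Qed.

(** The bound holds for every [x]; exponentiating it turns it into a lower bound
    of the set defining [C], which avoids moving [ln] through the infimum. *)
Lemma H_Gamma_le_ln_C (F : fieldType) : 3%N \in [pchar F] ->
  H R (Gamma F (3 ^ k)) <= ln (C R k).
Proof.
move=> F3; rewrite /H; set S := (X in sup X).
(* An empty set has supremum 0, which is below [ln C] as [C] is at least 1. *)
have [S0|S0] := pselect (S !=set0)%classic; last first.
  move/set0P/negP/negPn/eqP: S0 => ->; rewrite sup0 ln_ge0 //.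
  exact: le_C _ majorant_ge1.
apply: ge_sup => // _ [mu muG <-].
rewrite -[leLHS]expRK ler_ln ?posrE ?expR_gt0 ?C_gt0 //.
apply: le_C => x x1; rewrite -[leRHS]lnK.
  by rewrite ler_expR; exact: min_marginal_entropy_le muG x1.
exact: lt_le_trans ltr01 (majorant_ge1 _ x1).
Qed.

End Majorant.

(** * The constant gamma *)

Section GammaConstant.
Variable R : realType.
Local Notation s := (Num.sqrt 33 : R).

Lemma sqrt33_sq : s ^+ 2 = 33.
Proof. by rewrite sqr_sqrtr. Qed.

Lemma x0_ge1 : 1 <= x0 R.
Proof.
have : 3 <= s by rewrite -(@ler_pXn2r _ 2) ?nnegrE ?sqrtr_ge0 // sqrt33_sq; lra.
rewrite /x0; lra.
Qed.

(** Cubing removes the fractional power: gamma^3 = (1+x0+x0^2)^3 / x0^4.  Both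
    sides then reduce to linear polynomials in [x0] by x0^2 = (x0 + 4) / 2. *)
Lemma gamma_cube : gamma R ^+ 3 = 27 / 512 * (207 + 33 * s).
Proof.
have x1 := x0_ge1; have s2 := sqrt33_sq.
have sx : s = 4 * x0 R - 1 by rewrite /x0; lra.
have x2 : x0 R ^+ 2 = (x0 R + 4) / 2.
  by move: s2; rewrite sx => s2; lra.
rewrite /gamma exprMn sx x2 -[(x0 R `^ _) ^+ 3]powR_mulrn ?powR_ge0 //.
rewrite -powRrM (_ : - (4 / 3) * 3%:R = - 4%:R); last by lra.
rewrite powR_invn; last by lra.
apply: (canLR (mulfK _)); first by rewrite expf_eq0 /=; lra.
have x4 : x0 R ^+ 4 = (17 * x0 R + 36) / 8.
  rewrite (_ : x0 R ^+ 4 = x0 R ^+ 2 ^+ 2); last by rewrite -exprM.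
  rewrite x2 expr_div_n sqrrD x2; lra.
rewrite x4; set x := x0 R in x2 *.
have x3 : x ^+ 3 = (9 * x + 4) / 4 by rewrite exprS x2 mulrA mulrDr -expr2 x2; lra.
(* 1 + x + x^2 = 3 (2 + x) / 2, whose cube is the left side; the right side uses
   207 + 33 (4x - 1) = 174 + 132x. *)
rewrite [LHS](_ : _ = 27 / 8 * (8 + 12 * x + 6 * x ^+ 2 + x ^+ 3)); last by field.
rewrite [RHS](_ : _ = 27 / 4096 * (2244 * x ^+ 2 + 7710 * x + 6264)); last by field.
rewrite x3 x2; lra.
Qed.

(** Cubing is monotone, so the bounds on gamma follow from bounds on sqrt 33 by
    [gamma_cube].  The true value is 2.7551046130236..., about 1.3e-13 above the
    lower end of the interval; an error d in sqrt 33 moves gamma by about d / 13,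
    so twelve decimals of sqrt 33 suffice. *)
Lemma gamma_approx_error : `|gamma R - gamma_approx R| <= 1 / (2 * 10 ^+ 12).
Proof.
have g0 : 0 <= gamma R by rewrite mulr_ge0 ?powR_ge0 //; have := x0_ge1; nra.
(* The square root is replaced by a variable, and the decimals below by an
   equation, so that unification does not unfold them into unary numerals. *)
have [r [r0 r2 g3]] : exists r : R,
    [/\ 0 <= r, r ^+ 2 = 33 & gamma R ^+ 3 = 27 / 512 * (207 + 33 * r)].
  by exists s; rewrite sqrtr_ge0 sqrt33_sq gamma_cube.
have le_exp n (u v : R) : 0 <= u -> 0 <= v -> u ^+ n.+1 <= v ^+ n.+1 -> u <= v.
  by move=> u0 v0; rewrite ler_pXn2r ?nnegrE.
have [a aE] : {a : R | a = 5 + 744 / 10 ^+ 3 + 562 / 10 ^+ 6 + 646 / 10 ^+ 9}.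
  by eexists.
have rl : a + 538 / 10 ^+ 12 <= r.
  apply: (le_exp 1%N); [|exact: r0|rewrite r2]; rewrite aE; lra.
have ru : r <= a + 539 / 10 ^+ 12.
  apply: (le_exp 1%N); [exact: r0| |rewrite r2]; rewrite aE; lra.
rewrite ler_distl; apply/andP; split.
  by apply: (le_exp 2%N) => //; [|rewrite g3]; rewrite /gamma_approx; lra.
by apply: (le_exp 2%N) => //; [|rewrite g3]; rewrite /gamma_approx; lra.
Qed.

(** The case [k = 2] is 1 + 2.8^2 < 9; thereafter the right side triples while the
    left side grows by a factor below 3. *)
Lemma one_plus_gamma_exp_lt k : (2 <= k)%N -> 1 + gamma R ^+ k < 3 ^+ k.
Proof.
have := gamma_approx_error; rewrite ler_distl /gamma_approx => /andP[gl gu].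
have {}gl : 0 <= gamma R by lra.
have {}gu : gamma R <= 28 / 10 by lra.
case: k => [|[|k]] // _; elim: k => [|k IH].
  rewrite !expr2; nra.
rewrite exprS [3 ^+ k.+3]exprS.
have : 0 <= gamma R ^+ k.+2 by exact: exprn_ge0.
move: IH; set g := _ ^+ _; nra.
Qed.

End GammaConstant.

Theorem proposition3p4 (R : realType) (k : nat) (F : finFieldType) :
  (2 <= k)%N -> #|F| = (3 ^ k)%N ->
  [/\ H R (Gamma F (3 ^ k)) <= ln (C R k),
      C R k < 3 ^+ k,
      `|gamma R - gamma_approx R| <= 1 / (2 * 10 ^+ 12),
      C R k <= 1 + gamma R ^+ k - x0 R `^ (- (4 * k%:R / 3))
    & 1 + gamma R ^+ k - x0 R `^ (- (4 * k%:R / 3)) < 1 + gamma R ^+ k].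
Proof.
move=> k2 cardF; have x1 := x0_ge1 R.
have F3 : 3%N \in [pchar F] by apply: (card_finPcharP cardF).
have Cle : C R k <= 1 + gamma R ^+ k - x0 R `^ (- (4 * k%:R / 3)).
  apply: le_trans (C_le_majorant _ _ _ x1) _; rewrite /majorant le_eqVlt.
  apply/orP; left; apply/eqP; rewrite mulrBr mulr1 addrA; congr (1 + _ - _).
  rewrite /gamma [RHS]exprMn mulrC -[(_ `^ _) ^+ k]powR_mulrn ?powR_ge0 // -powRrM.
  by congr (_ * _ `^ _); lra.
have lt1 : 1 + gamma R ^+ k - x0 R `^ (- (4 * k%:R / 3)) < 1 + gamma R ^+ k.
  by rewrite ltrBlDr ltrDl powR_gt0 //; lra.
split=> //; first exact: H_Gamma_le_ln_C.
  exact: le_lt_trans Cle (lt_trans lt1 (one_plus_gamma_exp_lt R k k2)).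
exact: gamma_approx_error.
Qed.
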